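(* Let $(X,D,P)$ be a complete perturbed metric space with exact metric $d=D-P$. Let $T:X\to X$ and let $a,b,c,h,e\ge 0$ be such that for all $x,y\in X$ $$D(Tx,Ty)\le a\,D(x,y)+b\,D(x,Tx)+c\,D(y,Ty)+h\,D(x,Ty)+e\,D(y,Tx).$$ Let $a_0,b_0,c_0,h_0,e_0\ge 0$ be constants such that for all $x,y\in X$ $$a\,P(x,y)+b\,P(x,Tx)+c\,P(y,Ty)+h\,P(x,Ty)+e\,P(y,Tx)\le a_0\,d(x,y)+b_0\,d(x,Tx)+c_0\,d(y,Ty)+h_0\,d(x,Ty)+e_0\,d(y,Tx),$$ and suppose $(a+a_0)+(b+b_0)+(c+c_0)+(h+h_0)+(e+e_0)<1$. Put $A=a+a_0$, $B=b+b_0$, $C=c+c_0$, $H=h+h_0$, $E=e+e_0$ and $$\kappa:=\frac{2A+B+C+H+E}{2-(B+C+H+E)}\in[0,1).$$ Let $x^\ast$ be the unique fixed point of $T$ (which exists under these hypotheses), let $x_0\in X$ and $x_{n+1}=Tx_n$ for $n\ge 0$. Then for all $n\ge 0$, $$d(x_n,x^\ast)\le\frac{\kappa^{\,n}}{1-\kappa}\,D(x_0,x_1).$$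
   Context: A perturbed metric space $(X,D,P)$ consists of a set $X$ and two functions $D,P:X\times X\to[0,\infty)$ such that $d(x,y):=D(x,y)-P(x,y)$ is a metric on $X$, called the exact metric. Neither $D$ nor $P$ is assumed symmetric. $(X,D,P)$ is called complete if the metric space $(X,d)$ is complete. *)

(* Defs.v *)
From mathcomp Require Export all_boot all_order all_algebra.
From mathcomp Require Export all_classical all_reals all_analysis.

Set Implicit Arguments.
Unset Strict Implicit.
Unset Printing Implicit Defensive.

Import Order.TTheory GRing.Theory Num.Theory.
Local Open Scope classical_set_scope.
Local Open Scope ring_scope.

(* The exact metric d = D - P is the distance [mdist] of the metric space X;
   being a metric is thus part of the structure of X, while neither D nor P
   is required to be symmetric. *)
Definition perturbed_metric (R : realType) (X : metricType R)
    (D P : X -> X -> R) : Prop :=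
  [/\ forall x y, 0 <= D x y,
      forall x y, 0 <= P x y &
      forall x y, mdist x y = D x y - P x y].

(* The library's [completeType] is necessarily pointed, whereas X may be
   empty here; hence a predicate, with the library's Cauchy filters and
   convergence applied to sequences. *)
Definition complete_metric (R : realType) (X : metricType R) : Prop :=
  forall u : nat -> X, cauchy (u @ \oo) -> exists l : X, u @ \oo --> l.

(* Main.v *)
(* The bound on the perturbation terms makes T a Hardy-Rogers map for the exact
   metric d. Exchanging x and y averages the coefficients, so that B and C (resp.
   H and E) may be taken equal. Applied to (x, T x), the averaged condition says
   that T shrinks the step d(x, T x) by the factor kappa; applied to (x, z) with
   z fixed, it says that T shrinks d(x, z) by the same factor. The former makes
   the orbits Cauchy, with limit fixed by T; the latter gives
   d(x_n, z) <= kappa^n d(x_0, z), while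
   d(x_0, z) <= d(x_0, x_1) + kappa d(x_0, z) bounds d(x_0, z). *)

Require Import Defs.
From mathcomp Require Import all_boot all_order all_algebra.
From mathcomp Require Import all_classical all_reals all_analysis.
From mathcomp Require Import ring lra.

Import Order.TTheory GRing.Theory Num.Theory.
Local Open Scope classical_set_scope.
Local Open Scope ring_scope.

Definition hardy_rogers {R : realType} {X : metricType R} (T : X -> X)
    (A S W : R) : Prop :=
  forall x y : X, mdist (T x) (T y) <=
    A * mdist x y + S * (mdist x (T x) + mdist y (T y))
    + W * (mdist x (T y) + mdist y (T x)).

Lemma perturbed_metric_mdist_le {R : realType} {X : metricType R}
    {D P : X -> X -> R} (x y : X) :
  perturbed_metric D P -> mdist x y <= D x y.
Proof. by case=> _ P_ge0 ->; rewrite gerBl. Qed.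

(** Substituting [D = d + P] on the right of the contraction leaves exactly the [P] terms that the
    second hypothesis bounds, while on the left [d <= D]. *)
Lemma perturbed_hardy_rogers {R : realType} {X : metricType R}
    {D P : X -> X -> R} {T : X -> X} {a b c h e a0 b0 c0 h0 e0 : R} :
  perturbed_metric D P ->
  (forall x y : X,
    D (T x) (T y) <= a * D x y + b * D x (T x) + c * D y (T y)
                     + h * D x (T y) + e * D y (T x)) ->
  (forall x y : X,
    a * P x y + b * P x (T x) + c * P y (T y) + h * P x (T y) + e * P y (T x)
    <= a0 * mdist x y + b0 * mdist x (T x) + c0 * mdist y (T y)
       + h0 * mdist x (T y) + e0 * mdist y (T x)) ->
  hardy_rogers T (a + a0) (((b + b0) + (c + c0)) / 2)
    (((h + h0) + (e + e0)) / 2).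
Proof.
move=> DP DT PT.
have DE u v : D u v = mdist u v + P u v by case: DP => _ _ ->; rewrite subrK.
have half x y : mdist (T x) (T y) <=
    (a + a0) * mdist x y + (b + b0) * mdist x (T x) + (c + c0) * mdist y (T y)
    + (h + h0) * mdist x (T y) + (e + e0) * mdist y (T x).
  have := perturbed_metric_mdist_le (T x) (T y) DP.
  by have := DT x y; have := PT x y; rewrite !DE; lra.
move=> x y; have := half x y; have := half y x.
by rewrite (metric_sym (T y) (T x)) (metric_sym y x); lra.
Qed.

(** For the pair [(x, T x)] one cross term is zero and the other is at most
    [d(x, T x) + d(T x, T (T x))]; the terms in [d(T x, T (T x))] are then moved to the left. *)
Lemma hardy_rogers_step {R : realType} {X : metricType R} {T : X -> X}
    {A S W : R} (x : X) :
  0 <= W -> S + W < 1 -> hardy_rogers T A S W ->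
  mdist (T x) (T (T x)) <= (A + S + W) / (1 - (S + W)) * mdist x (T x).
Proof.
move=> W0 SW1 /(_ x (T x)); rewrite mdistxx addr0 => TT.
have := ler_wpM2l W0 (metric_triangle x (T x) (T (T x))).
by rewrite mulrAC ler_pdivlMr ?subr_gt0//; lra.
Qed.

(** Here [d(z, T z) = 0], and [d(x, T x) <= d(x, z) + d(z, T x)] leaves [(S + W) d(T x, z)] to
    absorb on the left. *)
Lemma hardy_rogers_to_fixed {R : realType} {X : metricType R} {T : X -> X}
    {A S W : R} (x z : X) :
  0 <= S -> S + W < 1 -> hardy_rogers T A S W -> T z = z ->
  mdist (T x) z <= (A + S + W) / (1 - (S + W)) * mdist x z.
Proof.
move=> S0 SW1 /(_ x z) TT zE; move: TT.
rewrite zE mdistxx addr0 (metric_sym z (T x)) => TT.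
have := ler_wpM2l S0 (metric_triangle x z (T x)).
by rewrite (metric_sym z (T x)) mulrAC ler_pdivlMr ?subr_gt0//; lra.
Qed.

Lemma mdist_step_orbit {R : realType} {X : metricType R} {T : X -> X} {k : R}
    (x : X) (n : nat) :
  0 <= k -> (forall y, mdist (T y) (T (T y)) <= k * mdist y (T y)) ->
  mdist (iter n T x) (iter n.+1 T x) <= k ^+ n * mdist x (T x).
Proof.
move=> k0 kT; elim: n => [|n IH]; first by rewrite expr0 mul1r.
by rewrite exprS -mulrA (le_trans (kT _))// ler_wpM2l.
Qed.

Lemma mdist_orbit {R : realType} {X : metricType R} {T : X -> X} {k : R}
    (x : X) (n : nat) :
  0 <= k < 1 -> (forall y, mdist (T y) (T (T y)) <= k * mdist y (T y)) ->
  mdist x (iter n T x) <= mdist x (T x) / (1 - k).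
Proof.
move=> /andP[k0 k1] kT; have k1' : 0 < 1 - k by rewrite subr_gt0.
(* The start [x] is generalized: the orbit of [T x] is bounded first, then the step from [x] to
   [T x] is added. *)
elim: n x => [|n IH] x.
  by rewrite mdistxx divr_ge0 ?mdist_ge0 ?ltW.
rewrite iterSr (le_trans (metric_triangle _ (T x) _))//.
have -> : mdist x (T x) / (1 - k) =
    mdist x (T x) + k * mdist x (T x) / (1 - k) by field; rewrite gt_eqF.
by rewrite lerD2l (le_trans (IH _))// ler_pM2r ?invr_gt0.
Qed.

Lemma cauchy_orbit {R : realType} {X : metricType R} {T : X -> X} {k : R}
    (x : X) :
  0 <= k < 1 -> (forall y, mdist (T y) (T (T y)) <= k * mdist y (T y)) ->
  cauchy ((fun n => iter n T x) @ \oo).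
Proof.
move=> k01 kT; apply: cauchy_exP => eps eps0.
have /andP[k0 k1] := k01.
have : geometric (mdist x (T x) / (1 - k)) k @ \oo --> 0.
  by apply: cvg_geometric; rewrite ger0_norm.
move/cvgrPdist_lt => /(_ _ eps0)[N _ /(_ N (leqnn N))].
rewrite /= sub0r normrN => small.
(* The tail from [N] on is the orbit of [iter N T x], so it stays in a ball around that point, of
   radius controlled by [k ^+ N]. *)
exists (iter N T x); exists N => // n /= Nn.
rewrite ballEmdist /=.
rewrite -(subnK Nn) iterD (le_lt_trans (mdist_orbit _ _ k01 kT))//.
apply: le_lt_trans small; apply: le_trans (ler_norm _).
rewrite mulrAC ler_pM2r ?invr_gt0 ?subr_gt0// mulrC.
exact: mdist_step_orbit.
Qed.

(** Continuity of [T] is not assumed: the condition at [(u, l)], with [u] far along the orbit,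
    bounds [d(l, T l)] by [(S + W) d(l, T l)] plus small terms. *)
Lemma hardy_rogers_limit_fixed {R : realType} {X : metricType R} {T : X -> X}
    {A S W : R} (x l : X) :
  0 <= A -> 0 <= S -> 0 <= W -> A + S + S + W + W < 1 ->
  hardy_rogers T A S W -> (fun n => iter n T x) @ \oo --> l -> T l = l.
Proof.
move=> A0 S0 W0 sum1 TT xl; apply/esym/mdist_positivity/eqP.
rewrite eq_le mdist_ge0 andbT; apply/ler_addgt0Pl => eps eps0; rewrite addr0.
move: xl => /metricType_numDomainType.cvgrPdist_lt xl.
(* The small terms add up to less than [2 * (eps / 4)]; dividing by [1 - (S + W) >= 1 / 2] yields
   [eps]. *)
have e4 : 0 < eps / 4 by rewrite divr_gt0.
have [N _ near_l] := xl _ e4.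
have := near_l N (leqnn N); have := near_l N.+1 (leqnSn N); rewrite /= => l1 l0.
set u := iter N T x in l0 l1.
have := TT u l.
have := metric_triangle l (T u) (T l).
have t1 := metric_triangle u l (T u); have t2 := metric_triangle u l (T l).
rewrite (metric_sym u l) in t1 t2 *.
have := ler_wpM2l S0 t1; have := ler_wpM2l W0 t2.
have := ler_wpM2l A0 (ltW l0).
have := ler_wpM2l S0 (ltW l0); have := ler_wpM2l S0 (ltW l1).
have := ler_wpM2l W0 (ltW l0); have := ler_wpM2l W0 (ltW l1).
have half : S + W <= 1 / 2 by lra.
have := ler_wpM2r (mdist_ge0 l (T l)) half.
have := ler_wpM2r (ltW e4) (ltW sum1).
lra.
Qed.

Theorem proposition3p11 (R : realType) (X : metricType R)
  (D P : X -> X -> R)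
  (hDP : perturbed_metric D P)
  (hcomplete : complete_metric X)
  (T : X -> X)
  (a b c h e : R)
  (ha : 0 <= a) (hb : 0 <= b) (hc : 0 <= c) (hh : 0 <= h) (he : 0 <= e)
  (hT : forall x y : X,
    D (T x) (T y) <= a * D x y + b * D x (T x) + c * D y (T y)
                     + h * D x (T y) + e * D y (T x))
  (a0 b0 c0 h0 e0 : R)
  (ha0 : 0 <= a0) (hb0 : 0 <= b0) (hc0 : 0 <= c0) (hh0 : 0 <= h0)
  (he0 : 0 <= e0)
  (hP : forall x y : X,
    a * P x y + b * P x (T x) + c * P y (T y) + h * P x (T y) + e * P y (T x)
    <= a0 * mdist x y + b0 * mdist x (T x) + c0 * mdist y (T y)
       + h0 * mdist x (T y) + e0 * mdist y (T x))
  (hsum : (a + a0) + (b + b0) + (c + c0) + (h + h0) + (e + e0) < 1)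
  (x : nat -> X)
  (hx : forall n : nat, x n.+1 = T (x n)) :
  let A := a + a0 in
  let B := b + b0 in
  let C := c + c0 in
  let H := h + h0 in
  let E := e + e0 in
  let kappa := (2 * A + B + C + H + E) / (2 - (B + C + H + E)) in
  [/\ 0 <= kappa < 1,
      exists! xstar : X, T xstar = xstar &
      forall xstar : X, T xstar = xstar ->
        forall n : nat,
          mdist (x n) xstar <= kappa ^+ n / (1 - kappa) * D (x 0%N) (x 1%N)].
Proof.
move=> A B C H E kappa.
pose S := (B + C) / 2; pose W := (H + E) / 2.
have A_ge0 : 0 <= A by rewrite addr_ge0.
have S_ge0 : 0 <= S by rewrite divr_ge0// !addr_ge0.
have W_ge0 : 0 <= W by rewrite divr_ge0// !addr_ge0.
have sum1 : A + S + S + W + W < 1 by rewrite /S /W /A /B /C /H /E; lra.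
have SW1 : S + W < 1 by lra.
have HR : hardy_rogers T A S W := perturbed_hardy_rogers hDP hT hP.
have kappaE : kappa = (A + S + W) / (1 - (S + W)).
  rewrite /kappa (_ : 2 * A + B + C + H + E = 2 * (A + S + W)); last first.
    by rewrite /S /W; field.
  rewrite (_ : 2 - (B + C + H + E) = 2 * (1 - (S + W))); last first.
    by rewrite /S /W; field.
  by rewrite -mulf_div divff// mul1r.
(* The upper bound amounts to [A + S + W < 1 - (S + W)], which is [sum1]. *)
have kappa01 : 0 <= kappa < 1.
  apply/andP; split; rewrite kappaE; last by rewrite ltr_pdivrMr; lra.
  by rewrite divr_ge0//; lra.
have step y : mdist (T y) (T (T y)) <= kappa * mdist y (T y).
  by rewrite kappaE; exact: hardy_rogers_step.
have to_fixed y z : T z = z -> mdist (T y) z <= kappa * mdist y z.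
  by rewrite kappaE; exact: hardy_rogers_to_fixed.
have /andP[kappa_ge0 kappa_lt1] := kappa01.
split=> //.
  have [l xl] := hcomplete _ (cauchy_orbit (x 0%N) kappa01 step).
  have Tl : T l = l by exact: hardy_rogers_limit_fixed HR xl.
  (* Uniqueness: [d(l, z) <= kappa d(l, z)] with [kappa < 1] forces [d(l, z) = 0]. *)
  exists l; split=> // z Tz; apply/mdist_positivity.
  have := to_fixed l z Tz; have := mdist_ge0 l z; rewrite Tl => d_ge0 d_le.
  apply/eqP; rewrite eq_le d_ge0 andbT.
  by rewrite -(pmulr_rle0 _ (_ : 0 < 1 - kappa)) ?subr_gt0//; lra.
move=> z Tz n.
have x0z : mdist (x 0%N) z <= D (x 0%N) (x 1%N) / (1 - kappa).
  rewrite ler_pdivlMr ?subr_gt0//.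
  have := metric_triangle (x 0%N) (x 1%N) z.
  have := perturbed_metric_mdist_le (x 0%N) (x 1%N) hDP.
  by have := to_fixed (x 0%N) z Tz; rewrite -hx; lra.
(* Regrouped as [kappa ^+ n] times the bound in [x0z], the claim follows by induction. *)
rewrite -mulrA [_^-1 * _]mulrC.
elim: n => [|n IH]; first by rewrite expr0 mul1r.
by rewrite hx exprS -mulrA (le_trans (to_fixed _ _ Tz))// ler_wpM2l.
Qed.
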